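(* Let $G$ be a countably infinite commutative cancellative semigroup, let $\Phi$ be a Følner sequence in $G$, and let $c\in(0,1)$. Then there is a discordant set $A\subseteq G$ with $d_\Phi(A)=c$.
   Context: For $A\subseteq G$ and $g\in G$ write $g^{-1}A=\{x\in G: gx\in A\}$, and for $H\subseteq G$ write $H^{-1}A=\bigcup_{h\in H}h^{-1}A$. A set $A\subseteq G$ is thick if for every finite $F\subseteq G$ there is $g\in G$ with $Fg\subseteq A$; it is piecewise syndetic if $H^{-1}A$ is thick for some finite $H\subseteq G$. A (left) Følner sequence in $G$ is a sequence $\Phi=(\Phi_n)$ of nonempty finite subsets of $G$ with $\lim_{n\to\infty}|\Phi_n\cap g\Phi_n|/|\Phi_n|=1$ for every $g\in G$. Put $\overline{d}_\Phi(A)=\limsup_{n\to\infty}|A\cap\Phi_n|/|\Phi_n|$ and $d_\Phi(A)=\lim_{n\to\infty}|A\cap\Phi_n|/|\Phi_n|$ when the limit exists (the assertion $d_\Phi(A)=c$ includes existence of the limit). A set $A\subseteq G$ is discordant if it is not piecewise syndetic and there is some Følner sequence $\Psi$ in $G$ with $\overline{d}_\Psi(A)>0$. *)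

(* Defs.v *)
From mathcomp Require Import all_boot all_order all_algebra finmap.
From mathcomp Require Import all_classical all_reals all_analysis.

Set Implicit Arguments.
Unset Strict Implicit.
Unset Printing Implicit Defensive.

Import Order.TTheory GRing.Theory Num.Theory numFieldNormedType.Exports.

Local Open Scope classical_set_scope.
Local Open Scope ring_scope.

Definition cancellative (G : semigroupType) : Prop :=
  right_injective (@monoid.mul G) /\ left_injective (@monoid.mul G).

Definition translate_inv (G : semigroupType) (g : G) (A : set G) : set G :=
  [set x | A (g * x)%g].

Definition set_inv (G : semigroupType) (H : {fset G}) (A : set G) : set G :=
  \bigcup_(h in [set` H]) translate_inv h A.

Definition thick (G : semigroupType) (A : set G) : Prop :=
  forall F : {fset G}, exists g : G, [set (f * g)%g | f in [set` F]] `<=` A.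

Definition piecewise_syndetic (G : semigroupType) (A : set G) : Prop :=
  exists H : {fset G}, thick (set_inv H A).

Definition folner (R : realType) (G : semigroupType)
    (Phi : nat -> {fset G}) : Prop :=
  (forall n, Phi n != fset0) /\
  forall g : G,
    (#|` (Phi n `&` [fset (g * x)%g | x in Phi n])%fset|%:R / #|` Phi n|%:R : R)
      @[n --> \oo] --> (1 : R).

Definition rel_freq (R : realType) (G : semigroupType)
    (Phi : nat -> {fset G}) (A : set G) : R^nat :=
  fun n => #|` [fset x in Phi n | x \in A]%fset|%:R / #|` Phi n|%:R.

(* limn_sup is real-valued; it is the true limsup here since
   rel_freq takes its values in [0, 1]. *)
Definition upper_density (R : realType) (G : semigroupType)
    (Phi : nat -> {fset G}) (A : set G) : R :=
  limn_sup (rel_freq R Phi A).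

Definition has_density (R : realType) (G : semigroupType)
    (Phi : nat -> {fset G}) (A : set G) (c : R) : Prop :=
  rel_freq R Phi A @ \oo --> c.

Definition discordant (R : realType) (G : semigroupType) (A : set G) : Prop :=
  ~ piecewise_syndetic A /\
  exists Psi : nat -> {fset G}, folner R Psi /\ 0 < upper_density R Psi A.

(* Main.v *)
Require Import Defs.
From mathcomp Require Import all_boot all_order all_algebra finmap.
From mathcomp Require Import all_classical all_reals all_analysis.
From mathcomp Require Import lra.

Import Order.TTheory GRing.Theory Num.Theory numFieldNormedType.Exports.

Local Open Scope classical_set_scope.
Local Open Scope card_scope.
Local Open Scope ring_scope.

(** The set is built inside the classes of a partition of [G] into finite
    pieces.

    If the classes have bounded diameter, almost every point of an almost
    invariant finite set has its whole class in that set ([vanishing_boundary]).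
    So a set that fills a proportion close to [c] of every class has density
    close to [c] along every Folner sequence, and exactly [c] if the size of the
    classes tends to infinity and each class [C] receives the integer part of
    [c * #|C|] points ([has_density_of_partition]).

    It remains to find room for such a set outside a thickly syndetic set [D],
    that is, a set such that for every finite [H] there is a finite [F] with:
    every [g] has an [f] in [F] with [H f g] contained in [D].  A set that
    avoids such a [D] is not piecewise syndetic ([not_piecewise_syndetic]).  What
    is needed is that [D] takes at most a proportion [1 - c] of every class.

    One finite [H] is handled by a syndetic set [T] that is so sparse that a
    large finite set [M] containing [H] has disjoint translates [M t], for [t]
    in [T]; commutativity is what makes [T] syndetic in a semigroup, where one
    cannot go backwards ([link_free_syndetic]).  Merging old classes into new
    ones, one for each [t] in [T] and such that the new class contains [M t],
    and adding [H T] to [D], costs a proportion at most [#|H| / #|M|], as small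
    as desired.  Since the new partition is coarser than the old one, the
    proportions already secured are inherited ([next_stage]).  Iterating over an
    exhaustion of [G] gives partitions [cl k], coarser and coarser, and sets
    [D k], larger and larger, such that [D k] takes a proportion less than
    [1 - c] of every class of [cl k].

    The union of the [D k] need not leave any room, so the stages are glued:
    choose growing finite sets, each a union of classes, and in the [k]-th
    annulus between consecutive ones use only [cl k] and [D k]
    ([glue_partitions]).  Finite sets are irrelevant both for density and for
    thick syndeticity ([vanishing_finite], [avoid_finite]).  If the finite sets
    grow fast enough to swallow the terms of the Folner sequence on which the
    boundary of [cl k.+1] is not yet small, the boundary of the glued partition
    vanishes too ([vanishing_diagonal]): a term on a stretch where the boundary
    of [cl k] is already small and that of [cl k.+1] may still be large lies in
    the annuli up to the [k]-th, where classes are contained in those of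
    [cl k]. *)

(** * Bounded displacement in a commutative cancellative semigroup *)

Section Links.
Context {G : semigroupType}.
Hypothesis mulC : commutative (@monoid.mul G).
Hypothesis mulI : cancellative G.

Lemma mulgCA (a b x : G) : (a * (b * x) = b * (a * x))%g.
Proof. by rewrite !mulgA (mulC a). Qed.

(** The displacement between [x] and [y] belongs to the finite set of fractions
    [p.1 / p.2]; it need not exist as an element of [G].  Pairs of lists of
    fractions are multiplied when displacements are composed. *)
Definition linked (V : seq (G * G)) (x y : G) : Prop :=
  exists2 p, p \in V & (p.1 * x = p.2 * y)%g.

Lemma finite_linked V t : finite_set [set x | linked V x t].
Proof.
apply: (@sub_finite_set _ _ (\bigcup_(p in [set` V])
  ((fun x => p.1 * x)%g @^-1` [set (p.2 * t)%g]))).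
  by move=> x [p pV e]; exists p.
apply: bigcup_finite => [|p _]; first exact: finite_seq.
by apply: finite_preimage => [x y _ _ /mulI.1|]; last exact: finite_set1.
Qed.

Lemma common_multiple (e : G) (s : seq G) :
  exists p, forall a, a \in s -> exists q, p = (q * a)%g.
Proof.
elim: s => [|b s [p IH]]; first by exists e.
exists (b * p)%g => a; rewrite in_cons => /orP[/eqP->|/IH[q ->]].
  by exists p; rewrite mulC.
by exists (b * q)%g; rewrite mulgA.
Qed.

Definition link_free (V : seq (G * G)) (T : set G) : Prop :=
  forall t u, T t -> T u -> linked V t u -> t = u.

(** Zorn's lemma; the link goes in either direction because [V] need not be
    closed under inverses of fractions. *)
Lemma maximal_link_free V : exists2 S : set G, link_free V S &
  forall g, S g \/ exists2 s, S s & linked V g s \/ linked V s g.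
Proof.
have [F FP Ftot|S [Ssep Smax]] := @Zorn_bigcup G (link_free V).
  move=> t u [X FX Xt] [Y FY Yu].
  have [XY|YX] := Ftot _ _ FX FY.
    exact: (FP _ FY) (XY _ Xt) Yu.
  exact: (FP _ FX) Xt (YX _ Yu).
exists S => // g; apply: contrapT => /not_orP[Sg noS].
apply: (Smax (g |` S)); first split.
- by move=> x Sx; right.
- by move=> /(_ g (or_introl erefl)).
move=> t u [->|St] [->|Su] // ntu.
- by exfalso; apply: noS; exists u => //; left.
- by exfalso; apply: noS; exists t => //; right.
- exact: Ssep.
Qed.

(** For a maximal link-free set [S], every [g] satisfies [a g = b s] for some
    [s] in [S] and one of finitely many pairs [(a, b)].  Then [g] may lie ahead
    of [s], so [S] itself need not be syndetic.  Multiplying [S] by a common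
    multiple [m] of all the [b] repairs this, since [m s = (m / b) a g], and by
    cancellation it preserves link-freeness. *)
Lemma link_free_syndetic (e : G) V : exists2 T : set G, link_free V T &
  exists Q : seq G, forall g, exists2 q, q \in Q & T (q * g)%g.
Proof.
have [S Ssep Smax] := maximal_link_free V.
pose W := (e, e) :: V ++ [seq (p.2, p.1) | p <- V].
have SW g : exists2 s, S s & linked W s g.
  (* the pair (e, e) accounts for the points g that are in S themselves *)
  case: (Smax g) => [Sg|[s Ss [[p pV E]|[p pV E]]]].
  - by exists g => //; exists (e, e); rewrite ?mem_head.
  - exists s => //; exists (p.2, p.1) => //.
    by rewrite in_cons mem_cat (map_f (fun p => (p.2, p.1))) ?orbT.
  - by exists s => //; exists p; rewrite // in_cons mem_cat pV orbT.
have [m mP] := common_multiple e (unzip1 W).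
have /choice[f fP] (a : G) : exists q, a \in unzip1 W -> m = (q * a)%g.
  have [/mP[q ->]|_] := boolP (a \in unzip1 W); first by exists q.
  by exists e.
exists [set (m * s)%g | s in S].
  move=> _ _ [s Ss <-] [t St <-] [p pV]; rewrite !(mulgCA _ m) => /mulI.1 E.
  by congr (_ * _)%g; apply: Ssep => //; exists p.
exists [seq (f p.1 * p.2)%g | p <- W] => g.
have [s Ss [p pW E]] := SW g.
exists (f p.1 * p.2)%g; first exact: (map_f (fun p => (f p.1 * p.2)%g)).
by exists s => //; rewrite -mulgA -E mulgA -fP// (map_f fst).
Qed.

(** * Partitions into finite classes of bounded diameter *)

Definition partition_map (cl : G -> {fset G}) : Prop :=
  (forall x, x \in cl x) /\ (forall x y, y \in cl x -> cl y = cl x).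

Definition bounded_classes (cl : G -> {fset G}) : Prop :=
  exists V, forall x y, y \in cl x -> linked V x y.

(** The labels are the points of a sparse syndetic set [T].  A class that meets
    [M t] gets the label [t]; sparseness of [T] is chosen in terms of the
    diameter of the classes, so that no class meets two of the sets [M t].  Any
    other class gets a label that is near one of its points, so the classes with
    a given label are near each other. *)
Lemma coarse_label (e : G) (cl : G -> {fset G}) (M : {fset G}) :
  partition_map cl -> bounded_classes cl ->
  exists lab : G -> G, [/\
    forall x y, y \in cl x -> lab y = lab x,
    exists V, forall x, linked V x (lab x),
    forall x m, m \in M -> lab (m * lab x)%g = lab x &
    exists Q : seq G, forall g, exists2 q, q \in Q &
      forall m, m \in M -> lab (m * (q * g))%g = (q * g)%g].
Proof.
move=> [clx clE] [V VP].
pose V1 := [seq ((p.1 * l.1)%g, (p.2 * l.2)%g) |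
  p <- V, l <- [seq (l1, l2) | l1 <- enum_fset M, l2 <- enum_fset M]].
have [T Tsep [Q QP]] := link_free_syndetic e V1.
pose hits (C : {fset G}) t := T t /\ exists2 m, m \in M & (m * t)%g \in C.
pose jumps (C : {fset G}) t := T t /\ exists2 y, y \in C &
   exists2 q, q \in Q & t = (q * y)%g.
have hits_uniq x t u : hits (cl x) t -> hits (cl x) u -> t = u.
  move=> [Tt [m mM mt]] [Tu [l lM lu]]; apply: Tsep => //.
  have [p pV E] := VP (m * t)%g (l * u)%g ltac:(by rewrite (clE _ _ mt)).
  exists ((p.1 * m)%g, (p.2 * l)%g); last by rewrite /= -!mulgA.
  by apply/allpairsP; exists (p, (m, l)); split => //; apply/allpairsP;
    exists (m, l).
have /choice[F FP] (C : {fset G}) : exists t,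
    forall x, C = cl x -> (hits C t \/ jumps C t /\ ~ exists u, hits C u).
  have [[u Cu]|noC] := pselect (exists u, hits C u).
    by exists u => x _; left.
  have [[x Cx]|noX] := pselect (exists x, C = cl x).
    have [q qQ Tq] := QP x; exists (q * x)%g => y _; right; split=> //.
    by split=> //; exists x; [rewrite Cx; exact: clx | exists q].
  by exists e => x Cx; exfalso; apply: noX; exists x.
have hitE x t : hits (cl x) t -> F (cl x) = t.
  move=> h; case: (FP _ x erefl) => [h'|[_ []]]; last by exists t.
  exact: hits_uniq h' h.
have TF x : T (F (cl x)) by case: (FP _ x erefl) => [[]|[[]]].
have TM t m : T t -> m \in M -> F (cl (m * t)%g) = t.
  by move=> Tt mM; apply: hitE; split=> //; exists m.
exists (F \o cl); split => /=.
- by move=> x y /clE->.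
- exists ([seq (p.1, p.2 * m)%g | p <- V, m <- enum_fset M] ++
          [seq (q * p.1, p.2)%g | p <- V, q <- Q]) => x.
  case: (FP _ x erefl) => [[_ [m mM /VP[p pV E]]]|
      [[_ [y /VP[p pV E] [q qQ Eq]]] _]].
    exists (p.1, p.2 * m)%g; last by rewrite /= E mulgA.
    by rewrite mem_cat; apply/orP; left; apply/allpairsP; exists (p, m).
  exists (q * p.1, p.2)%g; last by rewrite /= Eq -mulgA E mulgCA.
  by rewrite mem_cat; apply/orP; right; apply/allpairsP; exists (p, q).
- by move=> x m mM; rewrite TM.
- by exists Q => g; have [q qQ Tq] := QP g; exists q => // m mM; rewrite TM.
Qed.

Lemma label_classes (lab : G -> G) :
  (exists V, forall x, linked V x (lab x)) ->
  exists cl : G -> {fset G}, [/\ partition_map cl, bounded_classes cl &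
    forall x y, (y \in cl x) <-> lab y = lab x].
Proof.
move=> [V VP].
have fin x : finite_set [set y | lab y = lab x].
  by apply: sub_finite_set (finite_linked V (lab x)) => y /= <-.
pose cl x := fset_set [set y | lab y = lab x].
have clE x y : (y \in cl x) <-> lab y = lab x.
  by rewrite in_fset_set//; split => [/set_mem|/mem_set].
exists cl; split => //.
  by split=> [x|x y /clE E]; [apply/clE | rewrite /cl E].
exists [seq (p.1 * q.2, p.2 * q.1)%g | p <- V, q <- V] => x y /clE E.
have [p pV Ep] := VP x; have [q qV Eq] := VP y.
exists (p.1 * q.2, p.2 * q.1)%g; first by apply/allpairsP; exists (p, q).
by rewrite /= -!mulgA Eq E (mulgCA p.2) -Ep mulgCA.
Qed.

(** The number [d x] is the index of the annulus of [x] in the exhaustion by the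
    sets [E k], where [E k] is the union of the classes of [cl k.+1] that meet
    [X k].  With the index [k.+1], both [E k] and [E k.+1] are unions of classes
    of [cl k.+1], hence so is the annulus between them, in which the classes of
    [cl k.+1] are used. *)
Lemma glue_partitions (cl : nat -> G -> {fset G}) (X : nat -> {fset G}) :
  (forall k, partition_map (cl k)) ->
  (forall k x, (cl k x `<=` cl k.+1 x)%fset) ->
  (forall k, (X k `<=` X k.+1)%fset) ->
  (forall x, exists k, x \in X k) ->
  exists d : G -> nat, [/\ partition_map (fun x => cl (d x) x),
    forall x y, y \in cl (d x) x -> d y = d x,
    forall k x, x \in X k -> (d x <= k)%N &
    forall k, finite_set [set x | (d x <= k)%N]].
Proof.
move=> clP clS XS Xcov.
have clM j k x : (j <= k)%N -> (cl j x `<=` cl k x)%fset.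
  move=> /subnK <-; elim: (k - j)%N => // i IH.
  exact: fsubset_trans IH (clS _ _).
have XM j k : (j <= k)%N -> (X j `<=` X k)%fset.
  move=> /subnK <-; elim: (k - j)%N => // i IH.
  exact: fsubset_trans IH (XS _).
pose E k := \bigcup_(x in [set` X k]) [set` cl k.+1 x].
have Efin k : finite_set (E k).
  by apply: bigcup_finite => // x _; exact: finite_fset.
have EM j k x : (j <= k)%N -> E j x -> E k x.
  move=> jk [y yX xy]; exists y; first exact: (fsubsetP (XM _ _ jk)).
  exact: (fsubsetP (clM j.+1 k.+1 y jk)).
have XE k x : x \in X k -> E k x by move=> xX; exists x => //=; apply (clP _).1.
have Esat k j x y : (j <= k.+1)%N -> y \in cl j x -> E k x -> E k y.
  move=> jk yx [z zX xz]; exists z => //=.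
  rewrite -((clP _).2 _ _ xz); exact: (fsubsetP (clM _ _ _ jk)).
have /choice[d dP] x : exists k, E k x /\ forall j, E j x -> (k <= j)%N.
  have ex : exists k, `[< E k x >].
    by have [k kX] := Xcov x; exists k; apply/asboolP/XE.
  case: (ex_minnP ex) => k /asboolP Ek kmin; exists k; split => // j Ej.
  by apply: kmin; apply/asboolP.
have dE k x : E k x -> (d x <= k)%N by apply: (dP x).2.
have d_cl x y : y \in cl (d x) x -> d y = d x.
  move=> yx; have dyx : (d y <= d x)%N.
    by apply: dE; apply: Esat yx (dP x).1.
  apply/eqP; rewrite eqn_leq dyx /= leqNgt; apply/negP => lt.
  suff /dE : E (d x).-1 x by case: (d x) lt => // n _; rewrite ltnn.
  apply: (@Esat _ (d x) y x); first by rewrite leqSpred.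
    by rewrite ((clP _).2 _ _ yx) (clP _).1.
  by apply: (EM (d y)) (dP y).1; rewrite -ltnS (ltn_predK lt).
exists d; split.
- split=> [x|x y yx]; first exact: (clP _).1.
  by rewrite (d_cl _ _ yx); apply: (clP _).2.
- exact: d_cl.
- by move=> k x /XE/dE.
- by move=> k; apply: sub_finite_set (Efin k) => x dx; apply: EM (dP x).1.
Qed.

End Links.

(** * Counting points of a set in a finite set *)

Section Mass.
Context {R : realType} {G : choiceType}.
Implicit Types (F : {fset G}) (A B : set G).

Definition mass F A : R := \sum_(x <- F) \1_A x.

Lemma massE F A : mass F A = #|` [fset x in F | x \in A]%fset|%:R.
Proof.
rewrite card_fset_sum1 natr_sum big_fset /= [RHS]big_mkcond /=.
by apply: eq_bigr => x _; rewrite indicE; case: (x \in A).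
Qed.

Lemma sum_cst F (a : R) : \sum_(x <- F) a = a * #|` F|%:R.
Proof. by rewrite big_const_seq count_predT iter_addr_0 mulr_natr. Qed.

Lemma ler_sum_fset F (f g : G -> R) : (forall x, x \in F -> f x <= g x) ->
  \sum_(x <- F) f x <= \sum_(x <- F) g x.
Proof.
by move=> fg; rewrite big_seq [leRHS]big_seq; apply: ler_sum.
Qed.

Lemma le_mass F A B : (forall x, x \in F -> A x -> B x) -> mass F A <= mass F B.
Proof.
move=> AB; apply: ler_sum_fset => x xF; rewrite !indicE ler_nat.
have [xA|//] := boolP (x \in A).
by rewrite mem_set//; apply: AB => //; exact: set_mem.
Qed.

Lemma mass_setU F A B : mass F (A `|` B) <= mass F A + mass F B.
Proof.
rewrite -big_split; apply: ler_sum_fset => x xF /=.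
rewrite !indicE in_setU -natrD ler_nat.
by case: (x \in A); case: (x \in B).
Qed.

Lemma mass_le_cover F A E : (forall x, x \in F -> A x -> x \in E) ->
  mass F A <= #|` E|%:R.
Proof.
move=> AE; rewrite massE ler_nat; apply: fsubset_leq_card.
by apply/fsubsetP => x; rewrite !inE => /andP[xF /set_mem]; exact: AE.
Qed.

Lemma card_le_mass F A : (forall x, x \in F -> A x) -> #|` F|%:R <= mass F A.
Proof.
move=> FA; rewrite massE ler_nat; apply: fsubset_leq_card.
by apply/fsubsetP => x xF; rewrite !inE /= xF mem_set//; exact: FA.
Qed.

(** Mass transport: each point of [S] spreads its value evenly over its
    class. *)
Lemma sum_class_average (cl : G -> {fset G}) (S : {fset G}) (f : G -> R) :
  (forall x, x \in cl x) -> (forall x y, y \in cl x -> cl y = cl x) ->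
  (forall x, x \in S -> (cl x `<=` S)%fset) ->
  \sum_(x <- S) (\sum_(y <- cl x) f y) / #|` cl x|%:R = \sum_(x <- S) f x.
Proof.
move=> clx clE Ssat.
have clC x y : (y \in cl x) = (x \in cl y).
  by apply/idP/idP => /clE ->; exact: clx.
transitivity (\sum_(x <- S) \sum_(y <- S | y \in cl x) f y / #|` cl y|%:R).
  rewrite big_seq [RHS]big_seq; apply: eq_bigr => x xS.
  rewrite mulr_suml [RHS]big_fset_condE /=.
  rewrite big_seq; transitivity (\sum_(y <- cl x | y \in cl x) f y / #|` cl y|%:R).
    by apply: eq_bigr => y /clE ->.
  rewrite -big_seq; apply: eq_fbigl => y; rewrite !inE /=.
  have [yx|//] := boolP (y \in cl x); last by rewrite andbF.
  by rewrite (fsubsetP (Ssat _ xS) _ yx).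
rewrite (exchange_big_dep predT) //= big_seq [RHS]big_seq.
apply: eq_bigr => y yS.
rewrite (eq_bigl (fun x => x \in cl y)); last by move=> x; rewrite clC.
rewrite big_fset_condE /=.
have -> : [fset x in S | x \in cl y]%fset = cl y.
  apply/fsetP => x; rewrite !inE /=; apply: andb_idl => xy.
  exact: (fsubsetP (Ssat _ yS)).
rewrite sum_cst divfK// pnatr_eq0 cardfs_eq0; apply/negP => /eqP e.
by have := clx y; rewrite e inE.
Qed.

(** * Sets of density zero along a sequence of finite sets *)

Variable Phi : nat -> {fset G}.

(** [E] depends on [n] because boundaries do. *)
Definition vanishing (E : nat -> set G) : Prop :=
  forall eps : R, 0 < eps ->
    \forall n \near \oo, mass (Phi n) (E n) <= eps * #|` Phi n|%:R.

Lemma vanishingS (E F : nat -> set G) :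
  (forall n x, x \in Phi n -> E n x -> F n x) -> vanishing F -> vanishing E.
Proof.
move=> EF nF eps e0; near=> n; apply: le_trans (_ : mass (Phi n) (F n) <= _).
  by apply: le_mass; exact: EF.
by near: n; exact: nF.
Unshelve. all: by end_near. Qed.

Lemma vanishingU (E F : nat -> set G) : vanishing E -> vanishing F ->
  vanishing (fun n => E n `|` F n).
Proof.
move=> nE nF eps e0; have e20 : 0 < eps / 2 by rewrite divr_gt0.
near=> n; apply: le_trans (mass_setU _ _ _) _.
rewrite (splitr eps) mulrDl lerD//; near: n; [exact: nE|exact: nF].
Unshelve. all: by end_near. Qed.

(** By [sum_class_average], on the union of the classes contained in [Phi n] the
    function [\1_A - c] can be replaced by its class averages.  In
    absolute value these are at most the inverse of the class size, small except
    on a finite set, and what is left is the boundary. *)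
Lemma has_density_of_partition (cl : G -> {fset G}) (A : set G) (c : R) :
  (forall x, x \in cl x) -> (forall x y, y \in cl x -> cl y = cl x) ->
  (forall n, Phi n != fset0) ->
  (forall E : set G, finite_set E -> vanishing (fun=> E)) ->
  vanishing (fun n => [set x | ~ (cl x `<=` Phi n)%fset]) ->
  (forall K, finite_set [set x | (#|` cl x| < K)%N]) ->
  (forall x, c * #|` cl x|%:R - 1 <= mass (cl x) A <= c * #|` cl x|%:R) ->
  0 <= c <= 1 ->
  (fun n => mass (Phi n) A / #|` Phi n|%:R) @ \oo --> c.
Proof.
move=> clx clE Phi0 finN bdN clbig clA c01.
apply/cvgrPdist_le => eps e0.
have d0 : 0 < eps / 3 by rewrite divr_gt0.
set d := eps / 3 in d0.
pose E := [set x | (#|` cl x| < (Num.truncn d^-1).+1)%N].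
pose bad n := [set x | ~ (cl x `<=` Phi n)%fset].
pose f x : R := \1_A x - c.
have f1 x : `|f x| <= 1.
  have /andP[c0 c1] := c01.
  by rewrite /f indicE ler_norml; apply/andP; case: (x \in A) => /=; split; lra.
pose m x : R := (\sum_(y <- cl x) f y) / #|` cl x|%:R.
have cl0 x : 0 < #|` cl x|%:R :> R.
  by rewrite ltr0n cardfs_gt0; apply/eqP => e; have := clx x; rewrite e inE.
have mx x : `|m x| <= d + \1_E x.
  have -> : m x = mass (cl x) A / #|` cl x|%:R - c.
    by rewrite /m sumrB sum_cst mulrBl mulfK// gt_eqF.
  apply: le_trans (_ : #|` cl x|%:R^-1 <= _).
    have /andP[lo hi] := clA x.
    rewrite ler_norml; apply/andP; split.
      rewrite lerBrDr ler_pdivlMr// mulrDl mulNr mulVf ?gt_eqF//.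
      by rewrite addrC.
    apply: (@le_trans _ _ 0); last by rewrite invr_ge0 ltW.
    by rewrite subr_le0 ler_pdivrMr.
  rewrite indicE; have [xE|xE] := boolP (x \in E).
    apply: (@le_trans _ _ 1); last by rewrite lerDr ltW.
    by rewrite invf_le1// ler1n -(@ltr0n R).
  rewrite addr0 invf_ple ?posrE//.
  move: xE; rewrite notin_setE /E /= => /negP; rewrite -leqNgt => le.
  by apply: ltW; apply: lt_le_trans (truncnS_gt _) _; rewrite ler_nat.
near=> n.
have Pn : 0 < #|` Phi n|%:R :> R by rewrite ltr0n cardfs_gt0.
have E1 : mass (Phi n) E <= d * #|` Phi n|%:R.
  by near: n; apply: finN => //; exact: clbig.
have B1 : mass (Phi n) (bad n) <= d * #|` Phi n|%:R by near: n; exact: bdN.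
rewrite distrC.
have -> : mass (Phi n) A / #|` Phi n|%:R - c =
    (\sum_(x <- Phi n) f x) / #|` Phi n|%:R.
  by rewrite sumrB sum_cst mulrBl mulfK// gt_eqF.
rewrite normrM normfV (gtr0_norm Pn) ler_pdivrMr//.
rewrite (big_fsetID _ (fun x => `[< (cl x `<=` Phi n)%fset >])) /=.
set S := [fset x in Phi n | _]%fset.
set S' := [fset x in Phi n | ~~ _]%fset.
have good : `|\sum_(x <- S) f x| <= 2 * d * #|` Phi n|%:R.
  rewrite -(@sum_class_average cl)//; last first.
    move=> x; rewrite !inE /= => /andP[xP /asboolP cx].
    apply/fsubsetP => y yx; rewrite !inE /= (fsubsetP cx)//=.
    by apply/asboolP; rewrite (clE _ _ yx).
  apply: le_trans (ler_norm_sum _ _ _) _.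
  apply: (@le_trans _ _ (\sum_(x <- Phi n) (d + \1_E x))).
    apply: (@le_trans _ _ (\sum_(x <- S) (d + \1_E x))).
      by apply: ler_sum_fset => x _; exact: mx.
    rewrite big_fset /= big_mkcond /=; apply: ler_sum_fset => x _.
    by case: ifP => // _; rewrite addr_ge0// ltW.
  rewrite big_split /= sum_cst -mulrA mulr_natl mulr2n lerD//.
have badS : `|\sum_(x <- S') f x| <= d * #|` Phi n|%:R.
  apply: le_trans B1; apply: le_trans (ler_norm_sum _ _ _) _.
  rewrite big_fset /= big_mkcond /=; apply: ler_sum_fset => x _.
  rewrite indicE; case: ifPn => [|_]; last by rewrite ler0n.
  by rewrite -asbool_neg => /asboolP h; rewrite mem_set//; exact: f1.
apply: le_trans (ler_normD _ _) _.
have -> : eps * #|` Phi n|%:R = 2 * d * #|` Phi n|%:R + d * #|` Phi n|%:R.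
  by rewrite /d; lra.
by rewrite lerD.
Unshelve. all: by end_near. Qed.

End Mass.

(** * Boundaries are vanishing along a Folner sequence *)

Section Folner.
Context {R : realType} {G : semigroupType}.
Hypothesis mulI : cancellative G.
Variable Phi : nat -> {fset G}.
Hypothesis PhiF : folner R Phi.

Local Notation translate n g := ([fset (g * x)%g | x in Phi n])%fset.

Lemma folner_defect (g : G) (eps : R) : 0 < eps -> \forall n \near \oo,
  #|` Phi n|%:R - #|` (Phi n `&` translate n g)%fset|%:R <= eps * #|` Phi n|%:R.
Proof.
move=> e0; have /cvgrPdist_le/(_ _ e0) := PhiF.2 g.
apply: filterS => n le.
have Pn : 0 < #|` Phi n|%:R :> R by rewrite ltr0n cardfs_gt0 PhiF.1.
rewrite -ler_pdivrMr// mulrBl divff ?gt_eqF//.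
exact: le_trans (ler_norm _) le.
Qed.

(** The points that stay in [Phi n] under [a] cover the intersection of [Phi n]
    with its translate. *)
Lemma vanishing_exit (a : G) :
  vanishing (R := R) Phi (fun n => [set x | (a * x)%g \notin Phi n]).
Proof.
move=> eps e0; have := folner_defect a _ e0; apply: filterS => n; apply: le_trans.
set S := [fset x in Phi n | (a * x)%g \in Phi n]%fset.
rewrite lerBrDr (_ : mass _ _ = #|` (Phi n `\` S)%fset|%:R); last first.
  rewrite massE; congr (#|` _|%:R); apply/fsetP => x; rewrite !inE /=.
  case: (x \in Phi n) => //=; rewrite andbT.
  by apply/idP/idP => [/set_mem//|h]; exact: mem_set.
rewrite -natrD ler_nat -(cardfsID S (Phi n)) addnC leq_add2r.
have /fsetIidPr -> : (S `<=` Phi n)%fset by exact: fset_sub.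
have := leq_imfset_card imfset_key (fun x => (a * x)%g) (mem S).
apply: leq_trans.
apply: fsubset_leq_card; apply/fsubsetP => y; rewrite inE => /andP[yP].
move=> /imfsetP[x /= xP e]; apply/imfsetP; exists x => //=.
by rewrite !inE /= xP -e.
Qed.

Lemma vanishing_fresh (a b : G) : vanishing (R := R) Phi
  (fun n => [set x | (a * x)%g \in (Phi n `\` translate n b)%fset]).
Proof.
move=> eps e0; have := folner_defect b _ e0; apply: filterS => n; apply: le_trans.
rewrite massE -natrB; last by apply: fsubset_leq_card; exact: fsubsetIl.
rewrite ler_nat -cardfsD; set S := [fset x in Phi n | _]%fset.
have /= <- := @card_imfset imfset_key _ _ _ (mem S) (mulI.1 a).
apply: fsubset_leq_card; apply/fsubsetP => _ /imfsetP[x + ->] /=.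
by rewrite !inE /= => /andP[xP /set_mem]; rewrite /= !inE.
Qed.

(** If [a x = b y] with [x] in [Phi n] and [y] outside, then either [a x] has
    left [Phi n], or it is a point of [Phi n] outside the translate by [b], as
    cancellation determines [y] from [b y]. *)
Lemma vanishing_linked V : vanishing (R := R) Phi
  (fun n => [set x | exists2 y, linked V x y & y \notin Phi n]).
Proof.
elim: V => [|[a b] V IH].
  move=> eps e0; near=> n.
  apply: (@le_trans _ _ #|` (fset0 : {fset G})|%:R).
    by apply: mass_le_cover => x _ [y [p]].
  by rewrite cardfs0 mulr_ge0// ltW.
have van := vanishingU _ _ _ (vanishing_exit a)
  (vanishingU _ _ _ (vanishing_fresh a b) IH).
apply: vanishingS van => n x xP [y [p]].
rewrite in_cons => /orP[/eqP->/= e yP|pV e yP]; last first.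
  by right; right; exists y => //; exists p.
have [axP|axP] := boolP ((a * x)%g \in Phi n); last by left.
right; left; rewrite /= !inE axP andbT; apply/imfsetP => -[z /= zP].
by rewrite e => /mulI.1 yz; rewrite yz zP in yP.
Unshelve. all: by end_near. Qed.

Lemma vanishing_boundary (cl : G -> {fset G}) : bounded_classes cl ->
  vanishing (R := R) Phi (fun n => [set x | ~ (cl x `<=` Phi n)%fset]).
Proof.
move=> [V VP]; apply: vanishingS (vanishing_linked V) => n x _ /= h.
apply: contrapT => no; apply: h; apply/fsubsetP => y yx.
by apply/negPn/negP => yP; apply: no; exists y => //; exact: VP.
Qed.

Hypothesis Ginf : infinite_set [set: G].

(** Most points of [Phi n] stay in [Phi n] under all elements of a given finite
    set [S], and one such point has [#|S|] different images. *)
Lemma folner_card_infty K : \forall n \near \oo, (K <= #|` Phi n|)%N.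
Proof.
have [S _ SK] := infinite_set_fset K Ginf.
have nS : vanishing (R := R) Phi
    (fun n => [set x | exists2 g, g \in enum_fset S & (g * x)%g \notin Phi n]).
  elim: (enum_fset S) => [|g s IH].
    by apply: vanishingS (vanishing_linked [::]) => n x _ [g].
  apply: vanishingS (vanishingU _ _ _ (vanishing_exit g) IH) => n x _ [h].
  by rewrite in_cons => /orP[/eqP->|hs] ?; [left | right; exists h].
have h0 : 0 < 2^-1 :> R by rewrite invr_gt0.
have := nS _ h0; apply: filterS => n le.
have Pn : 0 < #|` Phi n|%:R :> R by rewrite ltr0n cardfs_gt0 PhiF.1.
have [x xP xS] : exists2 x, x \in Phi n &
    forall g, g \in S -> (g * x)%g \in Phi n.
  apply: contrapT => no.
  suff : #|` Phi n|%:R <= 2^-1 * #|` Phi n|%:R :> R by lra.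
  apply: le_trans le; apply: card_le_mass => x xP /=.
  apply: contrapT => no'; apply: no; exists x => // g gS.
  by apply/negPn/negP => gx; apply: no'; exists g.
apply: leq_trans SK _.
have /= <- := @card_imfset imfset_key _ _ _ (mem S) (mulI.2 x).
apply: fsubset_leq_card; apply/fsubsetP => _ /imfsetP[g gS ->].
exact: xS.
Qed.

Lemma vanishing_finite (E : set G) : finite_set E ->
  vanishing (R := R) Phi (fun=> E).
Proof.
move=> Efin eps e0; set e := #|` fset_set E|.
have := folner_card_infty (Num.truncn (e%:R / eps)).+1; apply: filterS => n le.
apply: (@le_trans _ _ e%:R).
  by apply: mass_le_cover => x _ Ex; rewrite in_fset_set// mem_set.
rewrite mulrC -ler_pdivrMr//; apply: ltW.
by apply: lt_le_trans (truncnS_gt _) _; rewrite ler_nat.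
Qed.

End Folner.

(** * Thickly syndetic sets *)

Section ThicklySyndetic.
Context {G : semigroupType}.
Hypothesis mulI : cancellative G.

Lemma not_piecewise_syndetic (A D : set G) :
  (forall H : {fset G}, exists F : {fset G}, forall g, exists2 f, f \in F &
    forall h, h \in H -> D (h * (f * g))%g) ->
  (forall x, A x -> ~ D x) -> ~ piecewise_syndetic A.
Proof.
move=> HD AD [H Hthick]; have [F FP] := HD H.
have [g Fg] := Hthick F; have [f fF HfD] := FP g.
have [h /= hH Ah] : set_inv H A (f * g)%g by apply: Fg; exists f.
exact: AD Ah (HfD h hH).
Qed.

(** Only finitely many [g], the set [W], are such that some [H q g] meets [E].
    Each of them can be pushed out of [W] by a suitable factor [u g], as [G] is
    infinite and cancellative. *)
Lemma avoid_finite (H Q : {fset G}) (B E : set G) :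
  infinite_set [set: G] -> finite_set E ->
  (forall g, exists2 q, q \in Q & forall h, h \in H -> B (h * (q * g))%g) ->
  exists F : {fset G}, forall g, exists2 f, f \in F &
    forall h, h \in H -> (B `\` E) (h * (f * g))%g.
Proof.
move=> Ginf Efin QP.
pose W := \bigcup_(h in [set` H]) \bigcup_(q in [set` Q])
  ((fun g => h * (q * g))%g @^-1` E).
have Wfin : finite_set W.
  apply: bigcup_finite => [|h _]; first exact: finite_fset.
  apply: bigcup_finite => [|q _]; first exact: finite_fset.
  by apply: finite_preimage Efin => x y _ _ /mulI.1/mulI.1.
have /choice[u uP] (g : G) : exists u, ~ W (u * g)%g.
  apply: contrapT => no; apply: Ginf.
  apply: (@sub_finite_set _ _ ((fun u => u * g)%g @^-1` W)).
    by move=> u _; apply: contrapT => nW; apply: no; exists u.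
  by apply: finite_preimage Wfin => x y _ _ /mulI.2.
exists (Q `|` [fset (q * u g)%g | q in Q, g in fset_set W])%fset => g.
have [Wg|nWg] := pselect (W g).
  have [q qQ qP] := QP (u g * g)%g; exists (q * u g)%g.
    rewrite inE; apply/orP; right; apply/imfset2P; exists q => //.
    by exists g; rewrite //= in_fset_set// mem_set.
  move=> h hH; rewrite -(mulgA q); split; first exact: qP.
  by move=> Eh; apply: (uP g); exists h => //; exists q.
have [q qQ qP] := QP g; exists q; first by rewrite inE qQ.
move=> h hH; split; first exact: qP.
by move=> Eh; apply: nWg; exists h => //; exists q.
Qed.

End ThicklySyndetic.

(** * Coarsening a partition while enlarging a thickly syndetic set *)

Section Stages.
Context {R : realType} {G : semigroupType}.
Hypothesis mulC : commutative (@monoid.mul G).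
Hypothesis mulI : cancellative G.
Hypothesis Ginf : infinite_set [set: G].

(** The strict inequality is the room for later stages: only the existence of
    some proportion below [tau] has to survive each step. *)
Definition stage (tau : R) (cl : G -> {fset G}) (D : set G) : Prop :=
  [/\ partition_map cl, bounded_classes cl & exists2 s : R, s < tau &
    forall x, mass (cl x) D <= s * #|` cl x|%:R].

(** [M] contains [H], is large enough to make new classes large, and makes the
    proportion of [H t] in the class of [t], which contains [M t], at most half
    of the remaining margin.  The old [D] keeps its proportion because each new
    class is a union of old ones. *)
Lemma next_stage (e : G) tau cl D (H : {fset G}) K : stage tau cl D ->
  exists cl' D', [/\ stage tau cl' D',
    forall x, (cl x `<=` cl' x)%fset, D `<=` D',
    forall x, (K <= #|` cl' x|)%N &
    exists Q : {fset G}, forall g, exists2 q, q \in Q &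
      forall h, h \in H -> D' (h * (q * g))%g].
Proof.
move=> [clP clB [s st Ds]].
pose eps := (tau - s) / 2; have eps0 : 0 < eps by rewrite divr_gt0// subr_gt0.
pose h0 : R := #|` H|%:R.
have [B _ BK] :=
  infinite_set_fset (maxn K (Num.truncn (h0 / eps)).+1) Ginf.
pose M := (H `|` B)%fset.
have MB : (#|` B| <= #|` M|)%N by apply: fsubset_leq_card; exact: fsubsetUr.
have MK : (K <= #|` M|)%N by rewrite (leq_trans _ MB)// (leq_trans _ BK) ?leq_maxl.
have HM : h0 <= eps * #|` M|%:R.
  rewrite mulrC -ler_pdivrMr//; apply: ltW.
  apply: lt_le_trans (truncnS_gt _) _; rewrite ler_nat.
  by rewrite (leq_trans _ MB)// (leq_trans _ BK) ?leq_maxr.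
have [lab [labE labB labM [Q labQ]]] := coarse_label mulC mulI e cl M clP clB.
have [cl' [clP' clB' clE']] := label_classes mulC mulI lab labB.
have sub x : (cl x `<=` cl' x)%fset.
  by apply/fsubsetP => y /labE/clE'.
have Mcl x : (#|` M| <= #|` cl' x|)%N.
  have /= <- := @card_imfset imfset_key _ _ _ (mem M) (mulI.2 (lab x)).
  apply: fsubset_leq_card; apply/fsubsetP => _ /imfsetP[m mM ->].
  by apply/clE'; exact: labM.
pose T := [set t | forall m, m \in M -> lab (m * t)%g = t].
pose HT := [set y | exists2 t, T t & exists2 h, h \in H & y = (h * t)%g].
exists cl', (D `|` HT); split => //.
- split=> //; exists (s + eps).
    by rewrite /eps; lra.
  move=> x; apply: le_trans (mass_setU _ _ _) _; rewrite mulrDl lerD//.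
    rewrite /mass -(sum_class_average cl (cl' x) _ clP.1 clP.2); last first.
      move=> y /clE' yx; apply/fsubsetP => z /labE zy; apply/clE'.
      by rewrite zy.
    rewrite -sum_cst; apply: ler_sum_fset => y _.
    rewrite ler_pdivrMr; first exact: Ds.
    rewrite ltr0n cardfs_gt0; apply/eqP => cl0.
    by have := clP.1 y; rewrite cl0 inE.
  apply: (@le_trans _ _ h0); last first.
    by apply: le_trans HM _; rewrite ler_wpM2l ?ler_nat// ltW.
  apply: (@le_trans _ _ #|` [fset (h * lab x)%g | h in H]%fset|%:R).
    apply: mass_le_cover => y /clE' yx [t Tt [h hH yE]].
    have <- : t = lab x by rewrite -yx yE Tt// inE hH.
    by apply/imfsetP; exists h.
  by rewrite ler_nat; have := leq_imfset_card imfset_key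
    (fun h => (h * lab x)%g) (mem H).
- by move=> x; exact: leq_trans MK (Mcl x).
exists [fset q in Q]%fset => g; have [q qQ qM] := labQ g.
exists q; first by rewrite inE.
by move=> h hH; right; exists (q * g)%g => //; exists h.
Qed.

Lemma stage_sequence (e : G) tau (H : nat -> {fset G}) : 0 < tau ->
  exists (cl : nat -> G -> {fset G}) (D : nat -> set G), [/\
    forall k, stage tau (cl k) (D k),
    forall k x, (cl k x `<=` cl k.+1 x)%fset,
    forall k, D k `<=` D k.+1,
    forall k x, (k <= #|` cl k x|)%N &
    forall k, exists Q : {fset G}, forall g, exists2 q, q \in Q &
      forall h, h \in H k -> D k.+1 (h * (q * g))%g].
Proof.
move=> tau0.
pose good (k : nat) (u v : (G -> {fset G}) * set G) :=
  [/\ stage tau v.1 v.2,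
    forall x, (u.1 x `<=` v.1 x)%fset, u.2 `<=` v.2,
    forall x, (k.+1 <= #|` v.1 x|)%N &
    exists Q : {fset G}, forall g, exists2 q, q \in Q &
      forall h, h \in H k -> v.2 (h * (q * g))%g].
have /choice[f fP] (ku : nat * ((G -> {fset G}) * set G)) : exists v,
    stage tau ku.2.1 ku.2.2 -> good ku.1 ku.2 v.
  have [st|nst] := pselect (stage tau ku.2.1 ku.2.2); last by exists ku.2.
  have [cl' [D' ?]] := next_stage e tau _ _ (H ku.1) ku.1.+1 st.
  by exists (cl', D').
pose s0 : (G -> {fset G}) * set G := (fun x => [fset x]%fset, set0).
pose s := fix s k := if k is k'.+1 then f (k', s k') else s0.
have st k : stage tau (s k).1 (s k).2.
  elim: k => [|k IH]; last by have [] := fP (k, s k) IH.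
  split=> /=.
  - split=> [x|x y]; first by rewrite inE.
    by rewrite inE => /eqP->.
  - exists [:: (e, e)] => x y; rewrite inE => /eqP->.
    by exists (e, e); rewrite ?mem_head.
  - exists 0 => // x; rewrite mul0r.
    apply: (@le_trans _ _ #|` (fset0 : {fset G})|%:R); last by rewrite cardfs0 mulr0n.
    by apply: mass_le_cover => y _ [].
have good_s k : good k (s k) (s k.+1) by exact: (fP (k, s k) (st k)).
exists (fun k => (s k).1), (fun k => (s k).2); split=> //.
- by move=> k x; have [] := good_s k.
- by move=> k; have [] := good_s k.
- by case=> // k x; have [] := good_s k.
- by move=> k; have [] := good_s k.
Qed.

End Stages.

Lemma sub_fset_card (T : choiceType) (U : {fset T}) m : (m <= #|` U|)%N ->
  exists2 B : {fset T}, (B `<=` U)%fset & #|` B| = m.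
Proof.
move=> mU; exists [fset x in take m U]%fset.
  by apply/fsubsetP => x; rewrite inE => /mem_take.
rewrite card_fseq undup_id ?take_uniq ?fset_uniq// size_take.
by case: ltngtP mU.
Qed.

Lemma select_fraction (R : realType) (T : choiceType) (C : {fset T})
    (D : set T) (c : R) : 0 <= c -> mass C D <= (1 - c) * #|` C|%:R ->
  exists B : {fset T}, [/\ (B `<=` C)%fset, forall x, x \in B -> ~ D x &
    c * #|` C|%:R - 1 <= #|` B|%:R <= c * #|` C|%:R].
Proof.
move=> c0 CD; set U := [fset x in C | x \notin D]%fset.
have CU : (#|` C| = #|` [fset x in C | x \in D]%fset| + #|` U|)%N.
  by rewrite !card_fset_sum1 (big_fsetID _ (fun x => x \in D)).
have UC : c * #|` C|%:R <= #|` U|%:R.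
  have : #|` C|%:R = mass C D + #|` U|%:R :> R by rewrite massE {1}CU natrD.
  lra.
have cC0 : 0 <= c * #|` C|%:R by rewrite mulr_ge0.
have [B BU Bm] : exists2 B : {fset T}, (B `<=` U)%fset &
    #|` B| = Num.truncn (c * #|` C|%:R).
  by apply: sub_fset_card; rewrite -(ler_nat R) (le_trans _ UC)// truncn_le.
exists B; split.
- by apply: fsubset_trans BU _; exact: fset_sub.
- by move=> x /(fsubsetP BU); rewrite !inE /= => /andP[_]; rewrite notin_setE.
- have /andP[lo hi] := truncn_itv cC0.
  by rewrite Bm lo andbT lerBlDr natr1 ltW.
Qed.

(** * The glued partition and the discordant set *)

(** A sequence that follows each [E k] on one of successive stretches of [n]
    vanishes if the [k]-th stretch starts late enough for [E k] to take a
    proportion at most [1 / (k + 1)]. *)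
Lemma vanishing_diagonal (R : realType) (G : choiceType) (Phi : nat -> {fset G})
    (E : nat -> nat -> set G) :
  (forall k, vanishing (R := R) Phi (E k)) ->
  exists N : nat -> nat, (forall k, (N k < N k.+1)%N) /\
    forall F : nat -> set G,
      (forall k n x, (N k <= n < N k.+1)%N -> x \in Phi n ->
        F n x -> E k n x) -> vanishing (R := R) Phi F.
Proof.
move=> vE.
have /choice[M MP] (k : nat) : exists m, forall n, (m <= n)%N ->
    mass (Phi n) (E k n) <= k.+1%:R^-1 * #|` Phi n|%:R :> R.
  have /(vE k) : 0 < k.+1%:R^-1 :> R by rewrite invr_gt0 ltr0n.
  by move=> [m _ mP]; exists m => n mn; exact: mP.
(* a sum rather than M k itself, to have a strictly increasing sequence *)
pose N k := (\sum_(j < k.+1) (M j).+1)%N.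
have NS k : N k.+1 = (N k + (M k.+1).+1)%N by rewrite /N big_ord_recr.
have NM k : (M k <= N k)%N.
  by rewrite /N big_ord_recr /= (leq_trans (leqnSn _))// leq_addl.
have Nlt k : (N k < N k.+1)%N by rewrite NS addnS ltnS leq_addr.
have Nk k : (k <= N k)%N by elim: k => // k IH; exact: leq_ltn_trans IH (Nlt k).
exists N; split=> // F FE eps e0.
pose k0 := Num.truncn eps^-1.
exists (N k0) => //= n kn.
have ex : exists k, (N k <= n)%N by exists k0.
have [k Nkn kmax] := ex_maxnP ex (fun k kn => leq_trans (Nk k) kn).
have nk1 : (n < N k.+1)%N.
  by rewrite ltnNge; apply/negP => /kmax; rewrite ltnn.
apply: le_trans (_ : mass (Phi n) (E k n) <= _).
  by apply: le_mass => x; apply: FE; rewrite Nkn.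
apply: le_trans (MP k n (leq_trans (NM k) Nkn)) _.
rewrite ler_wpM2r// invf_ple ?posrE//; apply: ltW.
by apply: lt_le_trans (truncnS_gt _) _; rewrite ler_nat ltnS kmax.
Qed.

Theorem corollary39 (R : realType) (G : semigroupType)
  (Gcount : [set: G] #= [set: nat])
  (Gcomm : commutative (@monoid.mul G))
  (Gcanc : cancellative G)
  (Phi : nat -> {fset G}) (PhiF : folner R Phi)
  (c : R) (c01 : 0 < c < 1) :
  exists A : set G, discordant R A /\ has_density Phi A c.
Proof.
have /andP[c0 c1] := c01.
have Ginf : infinite_set [set: G].
  by rewrite (eq_finite_set Gcount); exact: infinite_nat.
have [e _] : [set: G] !=set0.
  by apply/set0P/negP => /eqP G0; apply: Ginf; rewrite G0.
have /countable_injP[f finj] : countable [set: G].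
  by rewrite /countable; have := Gcount; rewrite card_eq_le => /andP[].
have fin_f k : finite_set [set x | (f x <= k)%N].
  apply: (@finite_preimage _ _ `I_k.+1 f); last exact: finite_II.
  by move=> x y _ _; apply: finj; rewrite in_setT.
pose H k := fset_set [set x | (f x <= k)%N].
have inH k x : (x \in H k) = (f x <= k)%N.
  by rewrite in_fset_set//; apply/idP/idP => [/set_mem|h]//; exact: mem_set.
have tau0 : 0 < 1 - c by rewrite subr_gt0.
have [cl [D [st clS DS clbig DH]]] :=
  stage_sequence Gcomm Gcanc Ginf e (1 - c) H tau0.
have DM j k : (j <= k)%N -> D j `<=` D k.
  move=> /subnK <-; elim: (k - j)%N => // i IH.
  exact: subset_trans IH (DS _).
have clP k : partition_map (cl k) by have [] := st k.
have clB k : bounded_classes (cl k) by have [] := st k.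
have bd k := vanishing_boundary Gcanc Phi PhiF (cl k) (clB k).
have [N [Nlt Nvan]] := vanishing_diagonal R G Phi _ bd.
(* X k swallows the terms of Phi up to the end of the k-th stretch, and f
   ensures that the X k exhaust G *)
pose X k := fset_set ([set x | exists2 n, (n < N k.+1)%N & x \in Phi n] `|`
                      [set x | (f x <= k)%N]).
have inX k x : (x \in X k) <->
    ((exists2 n, (n < N k.+1)%N & x \in Phi n) \/ (f x <= k)%N).
  rewrite in_fset_set; first by split => [/set_mem|h]//; exact: mem_set.
  rewrite finite_setU; split=> //.
  apply: (@sub_finite_set _ _ (\bigcup_(n in `I_(N k.+1)) [set` Phi n])).
    by move=> y [n nN yn]; exists n.
  by apply: bigcup_finite => // n _; exact: finite_fset.
have XS k : (X k `<=` X k.+1)%fset.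
  apply/fsubsetP => x /inX[[n nN xn]|fk]; apply/inX.
    by left; exists n => //; exact: ltn_trans nN (Nlt _).
  by right; exact: leqW.
have Xcov x : exists k, x \in X k by exists (f x); apply/inX; right.
have [d [[dclx dclE] dcl dX dfin]] := glue_partitions cl X clP clS XS Xcov.
pose C x := cl (d x) x.
have clM j k x : (j <= k)%N -> (cl j x `<=` cl k x)%fset.
  move=> /subnK <-; elim: (k - j)%N => // i IH.
  exact: fsubset_trans IH (clS _ _).
(* DD contains D k.+1 outside a finite set, as D is increasing *)
pose DD := [set x | D (d x) x].
have DDC x : mass (C x) DD <= (1 - c) * #|` C x|%:R.
  have [_ _ [s s1 sP]] := st (d x).
  apply: (@le_trans _ _ (mass (C x) (D (d x)))).
    by apply: le_mass => y yx; rewrite /DD /= (dcl _ _ yx).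
  by apply: le_trans (sP x) _; rewrite ler_wpM2r// ltW.
have /choice[sel selP] (K : {fset G}) : exists B : {fset G},
    mass K DD <= (1 - c) * #|` K|%:R ->
    [/\ (B `<=` K)%fset, forall x, x \in B -> ~ DD x &
      c * #|` K|%:R - 1 <= #|` B|%:R <= c * #|` K|%:R].
  have [h|nh] := pselect (mass K DD <= (1 - c) * #|` K|%:R).
    by have [B ?] := select_fraction R G K DD c (ltW c0) h; exists B.
  by exists fset0.
pose A := [set x | x \in sel (C x)].
have AC x : c * #|` C x|%:R - 1 <= mass (C x) A <= c * #|` C x|%:R.
  have [sub _] := selP _ (DDC x).
  suff -> : mass (C x) A = #|` sel (C x)|%:R :> R by [].
  apply/eqP; rewrite eq_le; apply/andP; split.
    by apply: mass_le_cover => y yx; rewrite /A /= /C (dclE _ _ yx).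
  rewrite massE ler_nat; apply: fsubset_leq_card; apply/fsubsetP => y ys.
  have yx := fsubsetP sub _ ys.
  by rewrite !inE /= yx mem_set// /A /= /C (dclE _ _ yx).
have dens : has_density Phi A c.
  have := @has_density_of_partition R G Phi C A c dclx dclE PhiF.1
    (vanishing_finite Gcanc Phi PhiF Ginf) _ _ AC.
  have -> : (fun n => mass (Phi n) A / #|` Phi n|%:R) = rel_freq R Phi A.
    by apply/funext => n; rewrite massE.
  apply.
  - apply: Nvan => k n x /andP[_ nk] xn; apply: contra_not.
    apply: fsubset_trans; apply: clM; apply: dX; apply/inX; left.
    by exists n.
  - move=> K; apply: sub_finite_set (dfin K) => x /= CK.
    by apply: ltnW; exact: leq_ltn_trans (clbig _ _) CK.
  - by rewrite !ltW.
exists A; split => //; split; last first.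
  exists Phi; split => //.
  by rewrite /upper_density cvg_limn_supE ?(cvg_lim _ dens)//; exact: cvgP dens.
apply: (@not_piecewise_syndetic _ _ DD); last first.
  by move=> x Ax; have [_ nD _] := selP _ (DDC x); exact: nD.
move=> K; pose k := (\max_(x <- K) f x)%N.
have KH x : x \in K -> x \in H k.
  by move=> xK; rewrite inH; exact: (@leq_bigmax_seq _ _ xpredT f).
have [Q QP] := DH k.
have QK g : exists2 q, q \in Q & forall h, h \in K -> D k.+1 (h * (q * g))%g.
  by have [q qQ qP] := QP g; exists q => // h /KH; exact: qP.
have [F FP] := avoid_finite Gcanc K Q _ _ Ginf (dfin k) QK.
exists F => g; have [u uF uP] := FP g; exists u => // h hK.
have [Dh /negP] := uP h hK.
by rewrite -ltnNge => kd; exact: DM Dh.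
Qed.
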